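(* Let $m,n\in\mathbb{N}$ with $n\le m$, let $\mathbf{A}=(a_{ij})\in\mathbb{R}^{n\times m}$, and let $X_1,\ldots,X_m$ be independent non-negative random variables. Let $\boldsymbol{\kappa}=(\kappa_1,\ldots,\kappa_m)^T$ be an optimal solution to the linear optimization problem $$\text{find } \mathbf{x}\in\mathbb{R}^m,\ \mathbf{x}\ge\mathbf{0},\ \text{such that } \mathbf{A}\mathbf{x}\ge\mathbf{1},\quad \sum_{i=1}^m x_i\to\min!$$ (a) Assume that all $X_j$, $1\le j\le m$, are regularly varying with index $-1$. Then for all $\epsilon>0$, $$x^{-\sum_{i=1}^m\kappa_i-\epsilon}=o\left(P\left(\prod_{j=1}^m X_j^{a_{ij}}>x,\ 1\le i\le n\right)\right),\quad x\to\infty.$$ (b) Assume that $E(X_j^{1-\delta})<\infty$, $1\le j\le m$, for all $\delta\in(0,1)$, and additionally that there exists $c>0$ such that $P(X_j\ge c)=1$ for all $1\le j\le m$ with $\kappa_j=0$. Then for all $\epsilon>0$, $$P\left(\prod_{j=1}^m X_j^{a_{ij}}>x,\ 1\le i\le n\right)=o\left(x^{-\sum_{i=1}^m\kappa_i+\epsilon}\right),\quad x\to\infty.$$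
   Context: Vector inequalities hold componentwise; $\mathbf{0}$ and $\mathbf{1}$ are column vectors of suitable dimension consisting of zeros, respectively ones. Conventions for products of powers of non-negative numbers: $0^a=+\infty$ for $a<0$, $0^0=1$, and $+\infty\cdot 0=0$; thus a product $\prod_j X_j^{a_{ij}}$ may take the value $+\infty$. A non-negative random variable $X$ is regularly varying with index $-1$ if $\lim_{x\to\infty}P(X>\lambda x)/P(X>x)=\lambda^{-1}$ for all $\lambda>0$. *)

(* Defs.v *)
From HB Require Import structures.
From mathcomp Require Import all_boot all_order all_algebra.
From mathcomp Require Import all_classical all_reals all_analysis.

Set Implicit Arguments.
Unset Strict Implicit.
Unset Printing Implicit Defensive.

Import Order.TTheory GRing.Theory Num.Theory.
Import numFieldNormedType.Exports.

Local Open Scope classical_set_scope.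
Local Open Scope ring_scope.

(* [powR] sets 0 `^ a = 0 for a < 0, whereas here 0^a = +oo for a < 0.  The
   remaining conventions, 0^0 = 1 and +oo * 0 = 0, are those of [powR] and of
   the multiplication of \bar R. *)
Definition expow (R : realType) (x a : R) : \bar R :=
  if (x == 0) && (a < 0) then +oo%E else (x `^ a)%:E.

(* Lets the filter +oo on R be used in the little-o notation. *)
Canonical pinfty_filter_on (R : numFieldType) : filter_on R :=
  FilterType (pinfty_nbhs R) _.

Definition lp_feasible (R : realType) (n m : nat) (A : 'M[R]_(n, m))
    (x : 'cV[R]_m) : Prop :=
  (forall j, 0 <= x j 0) /\ (forall i, 1 <= (A *m x) i 0).

Definition lp_objective (R : realType) (m : nat) (x : 'cV[R]_m) : R :=
  \sum_(j < m) x j 0.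

Definition lp_optimal (R : realType) (n m : nat) (A : 'M[R]_(n, m))
    (k : 'cV[R]_m) : Prop :=
  lp_feasible A k /\
  forall x, lp_feasible A x -> lp_objective k <= lp_objective x.

Section random_variables.
Context (d : measure_display) (T : measurableType d) (R : realType).
Variable P : probability T R.

Definition mutually_independent (m : nat) (X : 'I_m -> {RV P >-> R}) : Prop :=
  forall (J : {set 'I_m}) (B : 'I_m -> set R),
    (forall j, measurable (B j)) ->
    P [set w | forall j, j \in J -> B j (X j w)] =
    (\prod_(j in J) P (X j @^-1` B j))%E.

(* Real division by 0 is 0, so the limit, being nonzero, forces P(X > x) > 0
   for all large x. *)
Definition regularly_varying_N1 (X : {RV P >-> R}) : Prop :=
  forall lambda : R, 0 < lambda ->
    fine (ccdf X (lambda * x)) / fine (ccdf X x) @[x --> +oo] --> lambda^-1.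

Definition joint_tail (n m : nat) (A : 'M[R]_(n, m))
    (X : 'I_m -> {RV P >-> R}) (x : R) : R :=
  fine (P [set w | forall i : 'I_n,
                     (x%:E < \prod_(j < m) expow (X j w) (A i j))%E]).

End random_variables.

(* Main.v *)
Require Import Defs.
From HB Require Import structures.
From mathcomp Require Import all_boot all_order all_algebra.
From mathcomp Require Import all_classical all_reals all_analysis.
From mathcomp Require Import measurable_realfun ring lra.

Set Implicit Arguments.
Unset Strict Implicit.
Unset Printing Implicit Defensive.

Import Order.TTheory GRing.Theory Num.Theory.
Import numFieldNormedType.Exports.

Local Open Scope classical_set_scope.
Local Open Scope ring_scope.

(** On the scale [X j = x `^ y j] the event [\prod_j X j `^ A i j > x] reads
    [A y > 1], and [P (X j > x `^ y j)] is about [x `^ (- y j)] for [y j >= 0];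
    independence makes the probability of a point [y >= 0] about
    [x `^ (- \sum_j y j)]. The most likely way to realize the event minimizes
    [\sum_j y j] under [A y >= 1], which is the given linear program. Both parts
    turn this heuristic into a bound by a power of [x] whose exponent is as close
    as desired to the optimal value [K]; such a bound gives the little-o statement
    by [power_dominated].

    Lower bound ([joint_tail_lower]): the event contains a box where every [X j]
    lies in an octave [(t, 2 t]] above [t = x `^ y j], with [y] slightly larger
    than [kappa]. By regular variation each octave has probability at least
    [t `^ (- 1 - e)] up to a constant ([regularly_varying_octave]).

    Upper bound ([joint_tail_upper]): linear programming duality
    ([lp_dual_multipliers], from Farkas' lemma) yields weights [l >= 0] of total
    mass [K] such that [b j = \sum_i l i * A i j] is at most [1], with equality
    where [kappa j > 0]. Multiplying the [n] inequalities with these weights shows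
    that the event is contained, up to a null set, in
    [\prod_j X j `^ b j >= x `^ K], hence, up to a constant factor, in
    [\prod_j max 1 (X j) >= x `^ K] ([joint_event_sum_log]). The lower bound [c] matters where [b j] may be
    negative; where [kappa j > 0], [b j = 1] excludes [X j = 0] on the event, in
    spite of the convention [0 `^ a = +oo] for [a < 0]. The moment conditions bound
    the tails of the [X j] by Markov's inequality, and the tail of the product
    follows by covering the event with finitely many boxes ([sum_log_tail]). *)

(** * Farkas' lemma and linear programming duality *)

(** Bartl's induction on the number of functionals. Either the family without
    its first member [a] already suffices, or some [z] satisfies all the other
    constraints while [g z > 0]; then [a z > 0], and projecting along [z] onto
    the kernel of [a] turns the problem into one for the remaining functionals,
    restricted to that kernel. *)
Lemma farkas (R : realFieldType) (W : lmodType R) (I : eqType) (s : seq I)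
    (f : I -> W -> R) (g : W -> R) :
  uniq s -> (forall i, scalar (f i)) -> scalar g ->
  (forall x, (forall i, i \in s -> f i x <= 0) -> g x <= 0) ->
  exists2 u : I -> R, (forall i, 0 <= u i) &
    forall x, g x = \sum_(i <- s) u i * f i x.
Proof.
elim: s f g => [|a s IHs] f g /=.
  move=> _ _ lg g_le0; exists (fun=> 0) => // x.
  have gN y : g (- y) = - g y.
    have g0 : g 0 = 0 by have := lg (-1) 0 0; rewrite scaler0 addr0; lra.
    by have := lg (-1) y 0; rewrite scaleN1r addr0 g0; lra.
  have g1 := g_le0 x (fun i (h : i \in [::]) => ltac:(by [])).
  have g2 := g_le0 (- x) (fun i (h : i \in [::]) => ltac:(by [])).
  rewrite big_nil; rewrite gN in g2; lra.
move=> /andP[a_s us] lf lg g_le0.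
have [easy|/existsNP[z /not_implyP[z_le0 /negP]]] := pselect
    (forall x, (forall i, i \in s -> f i x <= 0) -> g x <= 0).
  have [u u_ge0 gE] := IHs f g us lf lg easy.
  exists (fun i => if i == a then 0 else u i) => [i|x]; first by case: ifP.
  rewrite big_cons eqxx mul0r add0r gE.
  apply: eq_big_seq => i i_s; case: eqP => // ia; by rewrite -ia i_s in a_s.
rewrite -ltNge => gz_gt0.
have az_gt0 : 0 < f a z.
  rewrite ltNge; apply/negP => az; move: gz_gt0; rewrite ltNge => /negP; apply.
  by apply: g_le0 => i; rewrite inE => /orP[/eqP ->|/z_le0].
pose f' i x := f i x - f i z / f a z * f a x.
pose g' x := g x - g z / f a z * f a x.
have sc h (lh : scalar h) : scalar (fun x => h x - h z / f a z * f a x).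
  by move=> c x y /=; rewrite lh (lf a); ring.
have [] := IHs f' g' us.
- by move=> i; apply: sc.
- exact: sc.
- move=> x x_le0; pose x' := (- (f a x / f a z)) *: z + x.
  have valx' h (lh : scalar h) : h x' = h x - h z / f a z * f a x.
    by rewrite /x' lh; ring.
  rewrite /g' -valx' //; apply: g_le0 => i; rewrite inE => /orP[/eqP ->|i_s].
    by rewrite valx' // divff ?gt_eqF // mul1r subrr.
  by rewrite valx' //; apply: x_le0.
move=> u u_ge0 g'E.
exists (fun i => if i == a then (g z - \sum_(j <- s) u j * f j z) / f a z
                 else u i) => [i|x].
  case: ifP => // _; apply: divr_ge0; last exact: ltW.
  rewrite subr_ge0; apply: le_trans (ltW gz_gt0).
  rewrite big_seq; apply: sumr_le0 => j /z_le0; exact: mulr_ge0_le0.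
rewrite big_cons eqxx.
have -> : g x = g' x + g z / f a z * f a x by rewrite /g' subrK.
rewrite g'E /f'.
have -> : \sum_(i <- s) (if i == a then (g z - \sum_(j <- s) u j * f j z) / f a z
                 else u i) * f i x = \sum_(i <- s) u i * f i x.
  apply: eq_big_seq => i i_s.
  by case: eqP => // ia; rewrite -ia i_s in a_s.
under eq_bigr do rewrite mulrBr.
rewrite sumrB.
have -> : \sum_(i <- s) u i * (f i z / f a z * f a x) =
          (\sum_(i <- s) u i * f i z) / f a z * f a x.
  by rewrite !mulr_suml; apply: eq_bigr => i _; rewrite !mulrA.
ring.
Qed.

(** Strong duality with complementary slackness. Homogenizing with an extra
    coordinate [t], optimality of [k] says that [A x >= t], [x >= 0], [t >= 0]
    imply [K t <= sum x], where [K] is the optimal value; Farkas' lemma writes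
    this inequality as a nonnegative combination of the constraints, and
    evaluating the combination at [(k, 1)], where the inequality is tight, shows
    that every term vanishes there. *)
Lemma lp_dual_multipliers (R : realType) (n m : nat) (A : 'M[R]_(n, m))
    (k : 'cV[R]_m) (k_opt : lp_optimal A k) :
  exists2 l : 'I_n -> R, (forall i, 0 <= l i) &
    [/\ \sum_i l i = lp_objective k,
        forall j, \sum_i l i * A i j <= 1 &
        forall j, k j 0 != 0 -> \sum_i l i * A i j = 1].
Proof.
have [[k_ge0 Ak_ge1] k_min] := k_opt.
pose K := lp_objective k.
pose W := ('cV[R]_m * R^o)%type.
(* Farkas' lemma takes the constraints in the form [f <= 0]. *)
pose f (i : 'I_n + 'I_m + unit) (p : W) : R := match i with
  | inl (inl i) => p.2 - (A *m p.1) i 0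
  | inl (inr j) => - p.1 j 0
  | inr _ => - p.2 end.
pose g (p : W) : R := K * p.2 - lp_objective p.1.
have lpZD c (x y : 'cV[R]_m) :
    lp_objective (c *: x + y) = c * lp_objective x + lp_objective y.
  by rewrite /lp_objective mulr_sumr -big_split; apply: eq_bigr => j _; rewrite !mxE.
have lp0 : lp_objective (0 : 'cV[R]_m) = 0.
  by rewrite /lp_objective big1 // => j _; rewrite mxE.
have lf i : scalar (f i).
  case: i => [[i|j]|u] c x y /=.
  - rewrite mulmxDr -scalemxAr !mxE /=.
    have -> (a b : R^o) : c *: a + b = c * a + b by [].
    ring.
  - rewrite !mxE; ring.
  - have -> (a b : R^o) : c *: a + b = c * a + b by [].
    ring.
have lg : scalar g.
  move=> c x y; rewrite /g lpZD /=.
  have -> (a b : R^o) : c *: a + b = c * a + b by [].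
  ring.
have g_le0 x : (forall i, i \in index_enum _ -> f i x <= 0) -> g x <= 0.
  case: x => x t fx.
  have {}fx i : f i (x, t) <= 0 by apply: fx; apply: mem_index_enum.
  have x_ge0 j : 0 <= x j 0 by have := fx (inl (inr j)); rewrite /= oppr_le0.
  have t_ge0 : 0 <= t by have := fx (inr tt); rewrite /= oppr_le0.
  have Ax i : t <= (A *m x) i 0 by have := fx (inl (inl i)); rewrite /= subr_le0.
  have key c (y : 'cV[R]_m) : 0 <= c -> (forall j, 0 <= y j 0) ->
      (forall i, 1 <= c * (A *m x) i 0 + (A *m y) i 0) ->
      K <= c * lp_objective x + lp_objective y.
    move=> c0 y0 Ay; rewrite -lpZD; apply: k_min; split=> [j|i].
      by rewrite !mxE addr_ge0 // mulr_ge0.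
    by rewrite mulmxDr -scalemxAr !mxE; have := Ay i; rewrite !mxE.
  rewrite /g /= subr_le0.
  (* For [t = 0], [x] is a recession direction and [k + x] is feasible;
     otherwise [x / t] is feasible. *)
  move: t_ge0; rewrite le_eqVlt => /predU1P[t0|t_gt0].
    rewrite -t0 mulr0.
    have := key 1 k ler01 k_ge0; rewrite /K mul1r lerDr; apply=> i.
    by rewrite mul1r -[leLHS]add0r lerD // t0.
  have := key t^-1 0; rewrite invr_ge0 (ltW t_gt0).
  rewrite lp0 mulmx0 addr0 mulrC ler_pdivlMr //; apply=> // [j|i].
    by rewrite mxE.
  by rewrite !mxE addr0 mulrC ler_pdivlMr // mul1r; have := Ax i; rewrite mxE.
have [u u_ge0 gE] := farkas (index_enum_uniq _) lf lg g_le0.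
have {}gE x t : K * t - lp_objective x =
    \sum_i u (inl (inl i)) * (t - (A *m x) i 0)
    - \sum_j u (inl (inr j)) * x j 0 - u (inr tt) * t.
  have := gE (x, t); rewrite /g /= => ->; rewrite !big_sumType /=.
  congr (_ + _ + _).
    by rewrite -sumrN; apply: eq_bigr => j _; rewrite mulrN.
  by rewrite (big_pred1 tt) ?mulrN //; case.
(* At [(k, 1)] the left-hand side vanishes and the terms on the right-hand side
   are nonpositive. *)
have gE0 := gE k 1.
have slack1 : 0 <= \sum_i u (inl (inl i)) * ((A *m k) i 0 - 1).
  by apply: sumr_ge0 => i _; rewrite mulr_ge0 // subr_ge0.
have slack2 : 0 <= \sum_j u (inl (inr j)) * k j 0.
  by apply: sumr_ge0 => j _; rewrite mulr_ge0.
have slack1E : \sum_i u (inl (inl i)) * (1 - (A *m k) i 0) =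
    - \sum_i u (inl (inl i)) * ((A *m k) i 0 - 1).
  by rewrite -sumrN; apply: eq_bigr => i _; rewrite -mulrN opprB.
rewrite slack1E -/K mulr1 subrr mulr1 in gE0.
have u0 := u_ge0 (inr tt).
have ut0 : u (inr tt) = 0 by lra.
have s20 : \sum_j u (inl (inr j)) * k j 0 = 0 by lra.
have col j : \sum_i u (inl (inl i)) * A i j + u (inl (inr j)) = 1.
  have := gE (delta_mx j 0) 0.
  have -> : lp_objective (delta_mx j 0) = 1 :> R.
    rewrite /lp_objective (bigD1 j) //= big1 ?addr0 ?mxE ?eqxx // => i ij.
    by rewrite mxE (negbTE ij).
  have -> : \sum_j0 u (inl (inr j0)) * (delta_mx j 0 : 'cV[R]_m) j0 0 =
            u (inl (inr j)).
    rewrite (bigD1 j) //= big1 ?addr0 ?mxE ?eqxx ?mulr1 // => i ij.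
    by rewrite mxE (negbTE ij) mulr0.
  have -> : \sum_i u (inl (inl i)) * (0 - (A *m (delta_mx j 0 : 'cV[R]_m)) i 0) =
            - \sum_i u (inl (inl i)) * A i j.
    rewrite -sumrN; apply: eq_bigr => i _.
    by rewrite -colE mxE sub0r mulrN.
  lra.
exists (fun i => u (inl (inl i))) => //; split.
- have := gE 0 1.
  rewrite lp0 mulmx0 ut0 -/K.
  have -> : \sum_j u (inl (inr j)) * (0 : 'cV[R]_m) j 0 = 0.
    by rewrite big1 // => j _; rewrite mxE mulr0.
  under eq_bigr do rewrite mxE subr0 mulr1.
  lra.
- by move=> j; rewrite -(col j) lerDl.
move=> j kj; rewrite -(col j).
have /eqP := s20; rewrite psumr_eq0; last by move=> i _; rewrite mulr_ge0.
move=> /allP /(_ j (mem_index_enum _)) /=.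
by rewrite mulf_eq0 (negbTE kj) orbF => /eqP ->; rewrite addr0.
Qed.

(** * Monomials, measurability and independence *)

Section monomials.
Context (R : realType).
Implicit Types x a : R.

Lemma expow_gt0 x a : 0 < x -> expow x a = (expR (a * ln x))%:E.
Proof. by move=> x_gt0; rewrite /expow gt_eqF //= /powR gt_eqF. Qed.

Lemma prod_expow (I : finType) (x a : I -> R) : (forall j, 0 < x j) ->
  (\prod_j expow (x j) (a j))%E = (expR (\sum_j a j * ln (x j)))%:E.
Proof.
move=> x_gt0; rewrite expR_sum -prodEFin; apply: eq_bigr => j _.
exact: expow_gt0.
Qed.

(** Since [0 * +oo = 0], one vanishing base with a positive exponent makes the
    whole monomial vanish, whatever the other factors are. *)
Lemma prod_expow_gt0 (I : finType) (x a : I -> R) j :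
  (0 < \prod_j expow (x j) (a j))%E -> 0 < a j -> x j != 0.
Proof.
move=> prod_gt0 a_gt0; apply: contraTneq prod_gt0 => xj0.
have xj_expow : expow (x j) (a j) = 0%E.
  by rewrite /expow xj0 eqxx lt_gtF //= powR0 // gt_eqF.
by rewrite (bigD1 j) //= xj_expow mul0e ltxx.
Qed.

Lemma measurable_expow a : measurable_fun setT (fun x : R => expow x a).
Proof.
rewrite /expow; have mpow : measurable_fun setT (fun x : R => (x `^ a)%:E).
  by apply/measurable_EFinP; exact: measurable_powR.
case: (a < 0); last by under eq_fun do rewrite andbF.
under eq_fun do rewrite andbT.
by apply: measurable_fun_ifT => //; apply: measurable_fun_eqr.
Qed.

End monomials.

Section probability.
Context (d : measure_display) (T : measurableType d) (R : realType).
Variable P : probability T R.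
Implicit Types A B : set T.

Lemma fine_prob_le A B : measurable A -> measurable B -> A `<=` B ->
  fine (P A) <= fine (P B).
Proof.
move=> mA mB AB; apply: fine_le; rewrite ?fin_num_measure //.
by apply: le_measure; rewrite ?inE.
Qed.

Lemma fine_prob_bigsetU (I : Type) (s : seq I) (Q : pred I) (F : I -> set T) :
  (forall i, measurable (F i)) ->
  fine (P (\big[setU/set0]_(i <- s | Q i) F i)) <=
  \sum_(i <- s | Q i) fine (P (F i)).
Proof.
move=> mF; rewrite -lee_fin -sumEFin fineK; last first.
  by apply: fin_num_measure; apply: bigsetU_measurable.
elim: s => [|i s IHs]; first by rewrite !big_nil measure0.
rewrite !big_cons; case: ifP => // _.
rewrite fineK ?fin_num_measure //.
apply: le_trans (leeD2l _ IHs).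
by apply: measureU2 => //; apply: bigsetU_measurable.
Qed.

Lemma measurable_forall (I : finType) (F : I -> set T) :
  (forall i, measurable (F i)) -> measurable [set w | forall i, F i w].
Proof.
move=> mF; have -> : [set w | forall i, F i w] = \bigcap_(i in setT) F i.
  by apply/seteqP; split => w /= h i => [_|]; apply: h.
by apply: fin_bigcap_measurable => //; apply: finite_finset.
Qed.

Lemma measurable_joint_event (n m : nat) (A : 'M[R]_(n, m))
    (X : 'I_m -> {RV P >-> R}) x :
  measurable [set w | forall i : 'I_n,
                     (x%:E < \prod_(j < m) expow (X j w) (A i j))%E].
Proof.
apply: (@measurable_forall _ (fun i => [set w |
  (x%:E < \prod_(j < m) expow (X j w) (A i j))%E])) => i.
rewrite -[X in measurable X]setTI; apply: measurable_lte => //.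
elim: (index_enum _) => [|j s IHs].
  by under eq_fun do rewrite big_nil; exact: measurable_cst.
under eq_fun do rewrite big_cons.
apply: emeasurable_funM => //.
by apply: (measurableT_comp (measurable_expow (A i j)) (measurable_funPT (X j))).
Qed.

Lemma measurable_box (m : nat) (X : 'I_m -> {RV P >-> R}) (B : 'I_m -> set R) :
  (forall j, measurable (B j)) -> measurable [set w | forall j, B j (X j w)].
Proof.
move=> mB; apply: (@measurable_forall _ (fun j => X j @^-1` B j)) => j.
exact: measurable_funPTI.
Qed.

Lemma prob_box (m : nat) (X : 'I_m -> {RV P >-> R}) (B : 'I_m -> set R) :
  mutually_independent X -> (forall j, measurable (B j)) ->
  fine (P [set w | forall j, B j (X j w)]) = \prod_j fine (P (X j @^-1` B j)).
Proof.
move=> X_indep mB.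
have -> : [set w | forall j, B j (X j w)] =
    [set w | forall j, j \in [set: 'I_m]%SET -> B j (X j w)].
  by apply/seteqP; split => w /= h j => [_|]; apply: h; rewrite ?inE.
apply: EFin_inj; rewrite fineK; last first.
  apply: fin_num_measure.
  have -> : [set w | forall j, j \in [set: 'I_m]%SET -> B j (X j w)] =
     [set w | forall j, B j (X j w)].
    by apply/seteqP; split => w /= h j => [|_]; apply: h; rewrite ?inE.
  exact: measurable_box.
rewrite X_indep // -prodEFin; apply: eq_big => [j|j _]; first by rewrite inE.
by rewrite fineK // fin_num_measure //; exact: measurable_funPTI.
Qed.

End probability.

(** * Upper bound *)

Section upper_bound.
Context (d : measure_display) (T : measurableType d) (R : realType).
Variable P : probability T R.

(** Markov's inequality for [x `^ a]; the moment is increased by [1] so that [C]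
    also bounds the probability of the sure event. *)
Lemma moment_tail (X : {RV P >-> R}) (a : R) : 0 <= a ->
  (forall w, 0 <= X w) -> ('E_P[(fun w => (X w `^ a)%R)] < +oo)%E ->
  exists2 C : R, 1 <= C &
    forall s, fine (P (X @^-1` `[expR s, +oo[)) <= C * expR (- (a * s)).
Proof.
move=> a_ge0 X_ge0 EX.
have EX_ge0 : (0 <= 'E_P[(fun w => (X w `^ a)%R)])%E.
  by apply: expectation_ge0 => w; exact: powR_ge0.
have EX_fin : ('E_P[(fun w => (X w `^ a)%R)])%E \is a fin_num.
  by rewrite ge0_fin_numE.
exists (fine 'E_P[(fun w => (X w `^ a)%R)]%E + 1) => [|s].
  by rewrite lerDr fine_ge0.
have : ((expR s `^ a)%:E * P [set w | ((expR s)%:E <= `|(X w)%:E|)%E]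
       <= 'E_P[(fun w => (X w `^ a)%R)])%E.
  have -> : (fun w => (X w `^ a)%R) =
      ((fun x : R => x `^ a) \o [eta Num.Def.normr]) \o X.
    by apply/funext => w /=; rewrite ger0_norm.
  apply: (@markov _ _ _ P X (fun x => x `^ a)) => //.
  - exact: expR_gt0.
  - by move=> r _; exact: powR_ge0.
  - by move=> x y x0 y0 xy; apply: ge0_ler_powR.
have -> : [set w | ((expR s)%:E <= `|(X w)%:E|)%E] = X @^-1` `[expR s, +oo[.
  by apply/seteqP; split => w /=;
    rewrite in_itv /= andbT lee_fin ger0_norm.
set p := P _; have p_fin : p \is a fin_num.
  by apply: fin_num_measure; exact: measurable_funPTI.
rewrite -[p]fineK // -(fineK EX_fin) -EFinM lee_fin /powR gt_eqF ?expR_gt0 //.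
rewrite expRK expRN => h.
rewrite -ler_pdivrMr ?invr_gt0 ?expR_gt0 // invrK mulrC.
by apply: le_trans h _; rewrite lerDl.
Qed.

(** The positive parts of the logarithms are capped at [r] and rounded down to
    multiples [r * k j / N]. Rounding loses less than [r / N] per variable, so [E]
    is covered by the boxes [X j >= exp (r * k j / N)] with [\sum_j k j >= N - m],
    whose probabilities factor. The number of boxes does not depend on [r], and
    the loss in the exponential rate vanishes as [N] grows. *)
Lemma sum_log_tail (m : nat) (X : 'I_m -> {RV P >-> R}) (C a : R) (N : nat) :
  mutually_independent X -> 1 <= C -> 0 <= a -> (0 < N)%N ->
  (forall j s, fine (P (X j @^-1` `[expR s, +oo[)) <= C * expR (- (a * s))) ->
  forall r E, 0 < r -> measurable E ->
    E `<=` [set w | r <= \sum_j Num.max 0 (ln (X j w))] ->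
  fine (P E) <=
    #|{ffun 'I_m -> 'I_N.+1}|%:R * C ^+ m * expR (- (a * r * (1 - m%:R / N%:R))).
Proof.
move=> X_indep C_ge1 a_ge0 N_gt0 X_tail r E r_gt0 mE E_sub.
have NR_gt0 : 0 < N%:R :> R by rewrite ltr0n.
pose lg j w := Num.max 0 (ln (X j w)).
(* A variable with [k j = 0] may be smaller than [1], or zero, and is left free. *)
pose B (c : 'I_N.+1) : set R :=
  if c == 0%N :> nat then setT else `[expR (r * c%:R / N%:R), +oo[%classic.
have mB c : measurable (B c) by rewrite /B; case: ifP.
pose G (k : {ffun 'I_m -> 'I_N.+1}) := [set w | forall j, B (k j) (X j w)].
have mG k : measurable (G k) by exact: (@measurable_box _ _ _ _ _ X (fun j => B (k j))).
pose S (k : {ffun 'I_m -> 'I_N.+1}) := (N <= \sum_j (k j : nat) + m)%N.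
have E_cover : E `<=` \big[setU/set0]_(k | S k) G k.
  move=> w /E_sub /= Ew.
  pose q j := (N%:R * lg j w / r).
  have lg_ge0 j : 0 <= lg j w by rewrite /lg le_max lexx.
  have q_ge0 j : 0 <= q j by rewrite /q divr_ge0 ?(ltW r_gt0) // mulr_ge0.
  pose k : {ffun 'I_m -> 'I_N.+1} := [ffun j => inord (minn N (Num.truncn (q j)))].
  have kE j : k j = minn N (Num.truncn (q j)) :> nat.
    by rewrite ffunE inordK // ltnS geq_minl.
  rewrite -bigcup_seq_cond; exists k.
    apply/andP; split; first exact: mem_index_enum.
    (* A single capped variable already accounts for the whole sum. *)
    rewrite /S; have [/existsP[j /eqP kj]|/existsPn k_lt] :=
        boolP [exists j, k j == N :> nat].
      by rewrite (bigD1 j) //= kj -addnA leq_addr.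
    have lt_k j : q j < (k j).+1%:R.
      have := k_lt j; rewrite kE; case: (leqP N) => // _; first by rewrite eqxx.
      by move=> _; exact: truncnS_gt.
    rewrite -(ler_nat R) natrD natr_sum.
    apply: (@le_trans _ _ (\sum_j q j)).
      rewrite /q -mulr_suml -mulr_sumr -mulrA ler_peMr ?(ltW NR_gt0) //.
      by rewrite ler_pdivlMr // mul1r.
    have -> : m%:R = \sum_(j < m) 1 :> R by rewrite sumr_const card_ord.
    rewrite -big_split /=; apply: ler_sum => j _.
    by rewrite natr1; exact/ltW/lt_k.
  move=> j /=; rewrite /B; case: eqP => // /eqP kj0; rewrite /= in_itv /= andbT.
  have k_le : (k j)%:R <= q j.
    by apply: (@le_trans _ _ (Num.truncn (q j))%:R);
      rewrite ?truncn_le // ler_nat kE geq_minr.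
  have k_gt0 : 0 < (k j)%:R :> R by rewrite ltr0n lt0n.
  have le_lg : r * (k j)%:R / N%:R <= lg j w.
    rewrite ler_pdivrMr //; move: k_le; rewrite /q ler_pdivlMr //.
    by rewrite mulrC [N%:R * _]mulrC.
  have lg_gt0 : 0 < lg j w.
    by apply: lt_le_trans le_lg; rewrite divr_gt0 // mulr_gt0.
  have ln_gt0 : 0 < ln (X j w) by move: lg_gt0; rewrite /lg lt_max ltxx.
  have X_gt0 : 0 < X j w.
    by rewrite ltNge; apply: contraTN ln_gt0 => /ln0 ->; rewrite ltxx.
  have lgE : lg j w = ln (X j w) by rewrite /lg max_r // ltW.
  by rewrite -(lnK X_gt0) ler_expR -lgE.
have B_tail j c : fine (P (X j @^-1` B c)) <= C * expR (- (a * (r * c%:R / N%:R))).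
  rewrite /B; case: eqP => [->|_] //.
  rewrite preimage_setT probability_setT mulr0 mul0r mulr0 oppr0 expR0 mulr1.
  exact: C_ge1.
have G_tail k : S k ->
    fine (P (G k)) <= C ^+ m * expR (- (a * r * (1 - m%:R / N%:R))).
  move=> Sk; rewrite (@prob_box _ _ _ _ _ X (fun j => B (k j))) //.
  apply: (@le_trans _ _ (\prod_j (C * expR (- (a * (r * (k j)%:R / N%:R)))))).
    by apply: ler_prod => j _; rewrite B_tail fine_ge0.
  rewrite big_split /= prodr_const card_ord -expR_sum.
  rewrite ler_pM2l ?exprn_gt0 ?(lt_le_trans _ C_ge1) // ler_expR sumrN lerN2.
  rewrite -mulr_sumr -mulrA ler_wpM2l // -mulr_suml -mulr_sumr -mulrA.
  rewrite ler_wpM2l ?(ltW r_gt0) // ler_pdivlMr // mulrBl mul1r divfK ?gt_eqF //.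
  by rewrite lerBlDr -natr_sum -natrD ler_nat.
have mU : measurable (\big[setU/set0]_(k | S k) G k).
  by apply: bigsetU_measurable.
apply: le_trans (fine_prob_le _ mE mU E_cover) _.
apply: le_trans (fine_prob_bigsetU _ _ _ mG) _.
apply: le_trans (ler_sum _ G_tail) _.
rewrite sumr_const -[leLHS]mulr_natl -[leRHS]mulrA; apply: ler_wpM2r.
  by rewrite mulr_ge0 ?expR_ge0 // exprn_ge0 // (le_trans _ C_ge1).
by rewrite ler_nat max_card.
Qed.

(** The inequalities of the event, weighted by the multipliers [l] of the dual
    program, combine to [K ln t <= \sum_j b j * ln (x j)] with exponents
    [b j <= 1]. A negative [b j] only occurs at an index where [x j >= c], and
    costs a constant. *)
Lemma joint_event_sum_log (n m : nat) (A : 'M[R]_(n, m)) (k : 'cV[R]_m)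
    (l : 'I_n -> R) (x : 'I_m -> R) (c t : R) :
  (forall i, 0 <= l i) -> (forall j, \sum_i l i * A i j <= 1) ->
  (forall j, k j 0 != 0 -> \sum_i l i * A i j = 1) ->
  (forall j, 0 <= x j) -> 0 < c -> (forall j, k j 0 = 0 -> c <= x j) -> 0 < t ->
  (forall i, t%:E < \prod_(j < m) expow (x j) (A i j))%E ->
  (\sum_i l i) * ln t - \sum_j `|(\sum_i l i * A i j) * ln c| <=
    \sum_j Num.max 0 (ln (x j)).
Proof.
move=> l_ge0 b_le1 b_eq1 x_ge0 c_gt0 x_gec t_gt0 x_ev.
have x_gt0 j : 0 < x j.
  have [kj0|kj0] := eqVneq (k j 0) 0; first exact: lt_le_trans (x_gec _ kj0).
  rewrite lt0r x_ge0 andbT.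
  (* As [b j = 1] is positive, so is some [A i j] with [l i > 0]. *)
  have [/existsP[i lA_gt0]|/existsPn lA_le0] := boolP [exists i, 0 < l i * A i j].
    apply: (@prod_expow_gt0 _ _ x (A i)).
      by apply: lt_trans (x_ev i); rewrite lte_fin.
    by rewrite ltNge; apply: contraTN lA_gt0 => A_le0; rewrite -leNgt mulr_ge0_le0.
  have : \sum_i l i * A i j <= 0.
    by apply: sumr_le0 => i _; rewrite leNgt lA_le0.
  by rewrite b_eq1 // ler10.
rewrite lerBlDr -big_split /=.
apply: (@le_trans _ _ (\sum_j (\sum_i l i * A i j) * ln (x j))).
  under [leRHS]eq_bigr do rewrite mulr_suml.
  rewrite exchange_big mulr_suml /=; apply: ler_sum => i _.
  under [leRHS]eq_bigr do rewrite -mulrA.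
  rewrite -mulr_sumr ler_wpM2l //.
  have := x_ev i; rewrite prod_expow // lte_fin -{1}(lnK t_gt0) ltr_expR.
  exact: ltW.
apply: ler_sum => j _; set b := \sum_i _.
have max_ge0 : 0 <= Num.max 0 (ln (x j)) by rewrite le_max lexx.
have max_geln : ln (x j) <= Num.max 0 (ln (x j)) by rewrite le_max lexx orbT.
have [b_ge0|b_lt0] := leP 0 b.
  apply: (@le_trans _ _ (b * Num.max 0 (ln (x j)))); first exact: ler_wpM2l.
  by apply: (@le_trans _ _ (Num.max 0 (ln (x j))));
    [rewrite ler_piMl // /b | rewrite lerDl].
have kj0 : k j 0 = 0.
  by apply/eqP; apply: contraTT b_lt0 => /b_eq1; rewrite /b => ->; rewrite ltr10.
apply: (@le_trans _ _ (b * ln c)); last first.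
  by apply: le_trans (ler_norm _) _; rewrite lerDr.
by rewrite ler_nM2l // ler_ln ?posrE // x_gec.
Qed.

(** Apply [sum_log_tail] at level [r = K * ln x - D], with moments of order
    [a = 1 - dl] and a grid of [N >= m / dl] cells: the rate becomes
    [K * (1 - dl) ^+ 2] at least, which exceeds [K - e]. *)
Lemma joint_tail_upper (n m : nat) (A : 'M[R]_(n, m)) (X : 'I_m -> {RV P >-> R})
    (k : 'cV[R]_m) (c e : R) :
  (forall j w, 0 <= X j w) -> mutually_independent X -> lp_optimal A k ->
  (forall j, forall delta : R, 0 < delta < 1 ->
      ('E_P[(fun w => (X j w `^ (1 - delta))%R)] < +oo)%E) ->
  0 < c -> (forall j, k j 0 = 0 -> P [set w | c <= X j w] = 1%E) -> 0 < e ->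
  exists C p : R, p < - lp_objective k + e /\
    \forall x \near +oo, joint_tail A X x <= C * expR (p * ln x).
Proof.
move=> X_ge0 X_indep k_opt X_mom c_gt0 X_gec e_gt0.
have [l l_ge0 [lK b_le1 b_eq1]] := lp_dual_multipliers k_opt.
set K := lp_objective k in lK *.
have K_ge0 : 0 <= K by apply: sumr_ge0 => j _; case: k_opt => [[]].
pose E x := [set w | forall i : 'I_n,
                     (x%:E < \prod_(j < m) expow (X j w) (A i j))%E].
have mE x : measurable (E x) by exact: measurable_joint_event.
(* For [K = 0] the level [r] would not become positive, but probabilities are at
   most [1]. *)
move: K_ge0; rewrite le_eqVlt => /predU1P[K0|K_gt0].
  exists 1, 0; rewrite -K0 oppr0 add0r; split=> //; near=> x.
  rewrite mul0r expR0 mulr1 -lee_fin fineK ?fin_num_measure //; last exact: mE.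
  by apply: probability_le1; exact: mE.
pose D := \sum_j `|(\sum_i l i * A i j) * ln c|.
pose dl := e / (2 * (K + e)).
have Ke_gt0 : 0 < 2 * (K + e) by lra.
have dl_gt0 : 0 < dl by rewrite divr_gt0.
have dl_K : 2 * (K + e) * dl = e by rewrite /dl mulrC divfK // gt_eqF.
have dl_lt1 : dl < 1 by rewrite ltr_pdivrMr //; lra.
pose a := 1 - dl.
have a_ge0 : 0 <= a by rewrite /a; lra.
have /fin_all_exists2[Cf Cf_ge1 Cf_tail] j := moment_tail a_ge0 (X_ge0 j)
  (X_mom j dl (introT andP (conj dl_gt0 dl_lt1))).
pose C := 1 + \sum_j Cf j.
have Cf_leC j : Cf j <= C.
  rewrite /C (bigD1 j) //=.
  have : 0 <= \sum_(i < m | i != j) Cf i.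
    by apply: sumr_ge0 => i _; rewrite (le_trans ler01).
  lra.
have C_ge1 : 1 <= C.
  by rewrite lerDl; apply: sumr_ge0 => j _; rewrite (le_trans ler01).
have X_tail j s : fine (P (X j @^-1` `[expR s, +oo[)) <= C * expR (- (a * s)).
  by apply: le_trans (Cf_tail j s) _; rewrite ler_wpM2r ?expR_ge0.
pose N := (Num.truncn (m%:R / dl)).+1.
pose th : R := 1 - m%:R / N%:R.
have N_gt0 : 0 < N%:R :> R by rewrite ltr0n.
have th_ge : 1 - dl <= th.
  rewrite /th lerD2l lerN2 ler_pdivrMr // mulrC -ler_pdivrMr //.
  exact/ltW/truncnS_gt.
have bound := sum_log_tail X_indep C_ge1 a_ge0 (ltn0Sn _ : (0 < N)%N) X_tail.
set F := (_%:R * C ^+ m) in bound.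
exists (F * expR (a * D * th)), (- (K * a * th)); split.
  have h1 : K * a * (1 - dl) <= K * a * th.
    by rewrite ler_wpM2l // mulr_ge0 // (ltW K_gt0).
  apply: (@le_lt_trans _ _ (- (K * a * (1 - dl)))); first by rewrite lerN2.
  have K_dl : K * dl < e / 2.
    have -> : K = (2 * (K + e)) / 2 - e by field.
    by rewrite mulrBl mulrAC dl_K; have := mulr_gt0 e_gt0 dl_gt0; lra.
  have K_dl2 : 0 <= K * dl * dl by apply: mulr_ge0; [apply: mulr_ge0|]; exact: ltW.
  rewrite /a; have -> : K * (1 - dl) * (1 - dl) = K - 2 * (K * dl) + K * dl * dl.
    by ring.
  lra.
(* By independence the almost sure lower bounds hold simultaneously. *)
pose J := [set j | k j 0 == 0]%SET.
pose H := [set w | forall j, j \in J -> `[c, +oo[%classic (X j w)].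
have mH : measurable H.
  have -> : H = [set w | forall j,
      (fun j => if j \in J then `[c, +oo[%classic else setT) j (X j w)].
    apply/seteqP; split => w /= Hw j; have := Hw j; case: ifP => //.
      by move=> jJ; apply.
  apply: (@measurable_box _ _ _ _ _ X
    (fun j => if j \in J then `[c, +oo[%classic else setT)) => j.
  by case: ifP.
have PH : P H = 1%E.
  rewrite /H (X_indep J (fun=> `[c, +oo[%classic)) //.
  apply: big1 => j; rewrite inE => /eqP kj0; rewrite -(X_gec j kj0).
  congr (P _); apply/seteqP; split=> w /=; by rewrite in_itv /= andbT.
near=> x.
have x_gt0 : 0 < x by near: x; exact: nbhs_pinfty_gt.
have r_gt0 : 0 < K * ln x - D.
  have lt_x : expR (D / K) < x by near: x; exact: nbhs_pinfty_gt.
  rewrite subr_gt0 mulrC -ltr_pdivrMr // -(expRK (D / K)).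
  by rewrite ltr_ln ?posrE ?expR_gt0.
have EH_sub : E x `&` H `<=`
    [set w | K * ln x - D <= \sum_j Num.max 0 (ln (X j w))].
  move=> w [Ew Hw] /=; rewrite -lK /D.
  apply: (joint_event_sum_log (k := k)) => // [j kj0].
  by have := Hw j; rewrite inE kj0 eqxx /= in_itv /= andbT; exact.
have mEH : measurable (E x `&` H) by apply: measurableI.
have -> : joint_tail A X x = fine (P (E x `&` H)).
  rewrite /joint_tail -/(E x); congr fine; apply/eqP; rewrite eq_le; apply/andP.
  split; last first.
    by apply: le_measure; rewrite ?inE //; exact: subIsetl.
  have -> : P (E x `&` H) = (P (E x `&` H) + P (~` H))%E.
    by rewrite probability_setC // PH subee // adde0.
  apply: le_trans (measureU2 _ mEH (measurableC mH)).
  apply: le_measure; rewrite ?inE //.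
    by apply: measurableU => //; exact: measurableC.
  by move=> w Ew; have [Hw|nHw] := pselect (H w); [left|right].
apply: le_trans (bound _ _ r_gt0 mEH EH_sub) _.
rewrite -/th -[leRHS]mulrA -expRD le_eqVlt; apply/orP; left; apply/eqP.
by congr (_ * expR _); ring.
Unshelve. all: by end_near.
Qed.

End upper_bound.

(** * Lower bound *)

(** If [F (2 t) / F t] tends to [1 / 2], halving [t] repeatedly down to a fixed
    range loses at most a factor [2 `^ (1 + e)] each time, whence a power lower
    bound for [F]; the increment [F t - F (2 t)] is comparable to [F t] because
    the limit is less than [1]. *)
Lemma halving_lower_bound (R : realType) (F : R -> R) (e : R) :
  (forall t, 0 <= F t) -> (forall s t, s <= t -> F t <= F s) -> 0 < e ->
  F (2 * t) / F t @[t --> +oo] --> (2^-1 : R) ->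
  exists2 c : R, 0 < c & exists M : R, forall s,
    M <= s -> c * expR (- ((1 + e) * s)) <= F (expR s) - F (2 * expR s).
Proof.
move=> F_ge0 F_noninc e_gt0 F_cvg.
pose q : R := expR (- ((1 + e) * ln 2)).
have ln2_gt0 : 0 < ln 2 :> R by rewrite ln_gt0 // ltr1n.
have expRNln2 : expR (- ln 2) = 2^-1 :> R by rewrite expRN lnK ?posrE.
have q_lt : q < 2^-1.
  by rewrite -expRNln2 ltr_expR mulrDl mul1r opprD gtrDl oppr_lt0 mulr_gt0.
(* The radius makes the ratio stay between [q] and [3 / 4]. *)
have /cvgrPdist_lt/(_ (2^-1 - Num.max q (4^-1))) := F_cvg.
have max_lt : Num.max q 4^-1 < 2^-1 :> R by rewrite gt_max q_lt /=; lra.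
rewrite subr_gt0 => /(_ max_lt) [M [_ near_half]].
have le_M x : M <= x -> M < expR x by have := expR_ge1Dx x; lra.
have ratio x : M <= x -> q < F (2 * expR x) / F (expR x) < 3 / 4.
  move=> /le_M/near_half; rewrite /= ltr_norml.
  have q_le : q <= Num.max q 4^-1 by rewrite le_max lexx.
  have q4_le : 4^-1 <= Num.max q 4^-1 by rewrite le_max lexx orbT.
  by move=> /andP[? ?]; apply/andP; split; lra.
have F_gt0 x : M <= x -> 0 < F (expR x).
  move=> /ratio/andP[h _]; rewrite lt0r F_ge0 andbT; apply/eqP => F0.
  by move: h; rewrite F0 invr0 mulr0 ltNge expR_ge0.
have F_dbl x : M <= x -> q * F (expR x) <= F (expR (x + ln 2)) <= 3 / 4 * F (expR x).
  move=> Mx; have := ratio x Mx; rewrite ltr_pdivlMr ?ltr_pdivrMr ?F_gt0 //.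
  by rewrite expRD lnK ?posrE // [expR x * 2]mulrC => /andP[/ltW-> /ltW->].
(* Chosen so that monotonicity of [F] gives the bound for [x] in [M, M + ln 2]. *)
pose c := F (expR (M + ln 2)) * expR ((1 + e) * M).
have c_gt0 : 0 < c by rewrite mulr_gt0 ?expR_gt0 // F_gt0 // lerDl ltW.
have e1_gt0 : 0 < 1 + e by lra.
have F_lower i x : M <= x -> x <= M + ln 2 *+ i.+1 ->
    c * expR (- ((1 + e) * x)) <= F (expR x).
  elim: i x => [|i IHi] x Mx.
    rewrite mulr1n => xM; apply: (@le_trans _ _ (F (expR (M + ln 2)))).
      rewrite /c -mulrA -expRD ler_piMr // expR_le1.
      by rewrite -mulrN -mulrDr mulr_ge0_le0 ?(ltW e1_gt0) // subr_le0.
    by apply: F_noninc; rewrite ler_expR.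
  have [xM _|xM xi] := leP x (M + ln 2).
    apply: IHi => //; apply: le_trans xM _.
    by rewrite lerD2l [leRHS]mulrS lerDl mulrn_wge0 // ltW.
  have Mx' : M <= x - ln 2 by rewrite lerBrDr ltW.
  have /andP[+ _] := F_dbl _ Mx'; rewrite subrK; apply: le_trans.
  have := IHi _ Mx'; rewrite lerBlDr -addrA -mulrSr => /(_ xi).
  rewrite -(ler_pM2l (expR_gt0 (- ((1 + e) * ln 2)))) -/q; apply: le_trans.
  rewrite mulrCA /q -expRD le_eqVlt; apply/orP; left; apply/eqP.
  by congr (_ * expR _); ring.
exists (c / 4); first by rewrite divr_gt0.
exists M => s Ms.
have {}F_lower : c * expR (- ((1 + e) * s)) <= F (expR s).
  apply: (F_lower (Num.truncn ((s - M) / ln 2))) => //.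
  rewrite -lerBlDl -[leRHS]mulr_natr mulrC -ler_pdivrMr //; exact/ltW/truncnS_gt.
have := F_dbl s Ms; rewrite expRD lnK ?posrE // [expR s * 2]mulrC => /andP[_ h].
have := F_gt0 s Ms.
by rewrite mulrAC; lra.
Qed.

Section lower_bound.
Context (d : measure_display) (T : measurableType d) (R : realType).
Variable P : probability T R.

Lemma regularly_varying_octave (X : {RV P >-> R}) (e : R) : 0 < e ->
  regularly_varying_N1 X ->
  exists2 c : R, 0 < c & exists M : R, forall s, M <= s ->
    c * expR (- ((1 + e) * s)) <= fine (P (X @^-1` `]expR s, 2 * expR s])).
Proof.
move=> e_gt0 /(_ 2 ltac:(by [])) X_rv.
have mX (B : set R) : measurable B -> measurable (X @^-1` B).
  exact: measurable_funPTI.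
have X_fin (B : set R) : measurable B -> P (X @^-1` B) \is a fin_num.
  by move=> mB; apply: fin_num_measure; exact: mX.
have [] := @halving_lower_bound _ (fun x => fine (ccdf X x)) e _ _ e_gt0 X_rv.
- by move=> t; apply: fine_ge0; exact: measure_ge0.
- move=> s t st; apply: fine_prob_le => // w /=.
  by rewrite !in_itv /= !andbT; exact: le_lt_trans.
move=> c c_gt0 [M F_lower]; exists c => //; exists M => s /F_lower.
move=> /le_trans; apply; rewrite lerBlDr.
pose B := X @^-1` `]expR s, 2 * expR s]; pose B' := X @^-1` `]2 * expR s, +oo[.
have mB : measurable B by exact: mX.
have mB' : measurable B' by exact: mX.
change (fine (P (X @^-1` `]expR s, +oo[)) <= fine (P B) + fine (P B')).
rewrite -fineD ?fin_num_measure //.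
apply: fine_le; rewrite ?fin_numD ?X_fin ?fin_num_measure //.
apply: le_trans (measureU2 _ mB mB').
apply: le_measure; rewrite ?inE; [exact: mX | exact: measurableU |].
move=> w; rewrite /B /B' /= !in_itv /= !andbT => ->.
by case: (leP (X w)) => _; [left|right].
Qed.

(** Enlarging a feasible [k] to [y = (1 + dl) *: k + dl' *: 1] makes all
    constraints strict and all coordinates positive at little cost in the
    objective. The event then contains the box where every [X j] lies in the
    octave above [x `^ (y j)]: replacing [X j] by the left end point changes the
    products by bounded factors only, which the slack in the constraints
    absorbs. *)
Lemma joint_tail_lower (n m : nat) (A : 'M[R]_(n, m)) (X : 'I_m -> {RV P >-> R})
    (k : 'cV[R]_m) (e : R) :
  mutually_independent X -> lp_feasible A k ->
  (forall j, regularly_varying_N1 (X j)) -> 0 < e ->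
  exists c p : R, [/\ 0 < c, - lp_objective k - e < p &
    \forall x \near +oo, c * expR (p * ln x) <= joint_tail A X x].
Proof.
move=> X_indep [k_ge0 Ak_ge1] X_rv e_gt0.
set K := lp_objective k.
have K_ge0 : 0 <= K by apply: sumr_ge0 => j _.
pose M : R := m%:R.
have M_ge0 : 0 <= M by [].
(* Small enough for [(1 + dl) * ((1 + dl) * K + dl * m) < K + e] when [dl < 1]. *)
pose dl := e / (3 * K + 2 * M + 1 + e).
have den_gt0 : 0 < 3 * K + 2 * M + 1 + e by lra.
have dl_gt0 : 0 < dl by rewrite divr_gt0.
have dlE : dl * (3 * K + 2 * M + 1 + e) = e by rewrite /dl divfK // gt_eqF.
have dl_lt1 : dl < 1 by rewrite ltr_pdivrMr //; lra.
pose S : R := \sum_i \sum_j `|A i j|.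
have S_ge0 : 0 <= S by apply: sumr_ge0 => i _; apply: sumr_ge0.
have S1_gt0 : 0 < S + 1 by lra.
pose dl' := dl / (S + 1).
have dl'_gt0 : 0 < dl' by rewrite divr_gt0.
have dl'E : dl' * (S + 1) = dl by rewrite /dl' divfK // gt_eqF.
have dl'_le : dl' <= dl.
  by rewrite ler_pdivrMr // ler_peMr ?(ltW dl_gt0) //; lra.
pose y j := (1 + dl) * k j 0 + dl'.
have y_gt0 j : 0 < y j.
  by apply: ltr_wpDl => //; apply: mulr_ge0 => //; lra.
have row_le i : \sum_j `|A i j| <= S.
  by rewrite /S (bigD1 i) //= lerDl; apply: sumr_ge0 => ? _; apply: sumr_ge0.
have Ay i : 1 + dl' <= \sum_j A i j * y j.
  have -> : \sum_j A i j * y j = (1 + dl) * (A *m k) i 0 + dl' * \sum_j A i j.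
    rewrite mxE !mulr_sumr -big_split; apply: eq_bigr => j _ /=; rewrite /y; ring.
  have h1 : 1 + dl <= (1 + dl) * (A *m k) i 0 by rewrite ler_peMr //; lra.
  have h2 : - S <= \sum_j A i j.
    rewrite lerNl; apply: le_trans (row_le i).
    by rewrite -sumrN; apply: ler_sum => j _; rewrite -normrN ler_norm.
  have h3 : dl' * - S <= dl' * \sum_j A i j by rewrite ler_pM2l.
  have h4 : dl' * S + dl' = dl by rewrite -[RHS]dl'E; ring.
  lra.
have /fin_all_exists2[cf cf_gt0 /fin_all_exists[Mf X_lower]] j :=
  regularly_varying_octave dl_gt0 (X_rv j).
pose Y := \sum_j y j.
have YE : Y = (1 + dl) * K + dl' * M.
  rewrite /Y big_split /= -mulr_sumr sumr_const card_ord.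
  by rewrite -mulr_natr.
exists (\prod_j cf j), (- ((1 + dl) * Y)); split.
- by apply: prodr_gt0 => j _.
- have Y_le : (1 + dl) * Y <= (1 + dl) * ((1 + dl) * K + dl * M).
    by rewrite ler_pM2l ?YE ?lerD2l ?ler_wpM2r //; lra.
  have dl2 : dl * dl <= dl by rewrite ler_piMr ?ltW.
  have h1 : dl * dl * K <= dl * K by rewrite ler_wpM2r.
  have h2 : dl * dl * M <= dl * M by rewrite ler_wpM2r.
  have h3 : 0 < dl * e by rewrite mulr_gt0.
  rewrite ltrBlDr -ltrBlDl.
  have h4 : (1 + dl) * ((1 + dl) * K + dl * M) =
    K + 2 * (dl * K) + dl * dl * K + dl * M + dl * dl * M by ring.
  have h5 : 3 * (dl * K) + 2 * (dl * M) + dl + dl * e = e.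
    by rewrite -[RHS]dlE; ring.
  lra.
near=> x.
have x_gt0 : 0 < x by near: x; exact: nbhs_pinfty_gt.
have lnx_ge b : expR b <= x -> b <= ln x.
  by move=> bx; rewrite -(expRK b) ler_ln ?posrE ?expR_gt0.
have lnx_gt b : expR b < x -> b < ln x.
  by move=> bx; rewrite -(expRK b) ltr_ln ?posrE ?expR_gt0.
have slack : S * ln 2 < dl' * ln x.
  have lt_x : expR (S * ln 2 / dl') < x by near: x; exact: nbhs_pinfty_gt.
  by rewrite [ltRHS]mulrC -ltr_pdivrMr // lnx_gt.
have large j : Mf j <= y j * ln x.
  rewrite -ler_pdivrMl //; apply: lnx_ge.
  have : expR (\sum_j `|(y j)^-1 * Mf j|) <= x by near: x; exact: nbhs_pinfty_ge.
  apply: le_trans; rewrite ler_expR.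
  apply: le_trans (ler_norm _) _; rewrite (bigD1 j) //= lerDl.
  by apply: sumr_ge0.
pose B j : set R := `]expR (y j * ln x), 2 * expR (y j * ln x)]%classic.
have mB j : measurable (B j) by exact: measurable_itv.
have box_sub : [set w | forall j, B j (X j w)] `<=` [set w | forall i : 'I_n,
    (x%:E < \prod_(j < m) expow (X j w) (A i j))%E].
  move=> w /= Bw i.
  have {}Bw j : expR (y j * ln x) < X j w /\ X j w <= 2 * expR (y j * ln x).
    by have := Bw j; rewrite /B /= in_itv /= => /andP.
  have Xw_gt0 j : 0 < X j w by apply: lt_trans (Bw j).1; exact: expR_gt0.
  rewrite prod_expow // lte_fin -[ltLHS]lnK ?posrE // ltr_expR.
  apply: (@lt_le_trans _ _ ((\sum_j A i j * y j) * ln x - S * ln 2)).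
    have lnx_ge0 : 0 <= ln x.
      have : 0 <= S * ln 2 by rewrite mulr_ge0 // ln_ge0 // ler1n.
      by move=> h; rewrite -(pmulr_rge0 _ dl'_gt0); lra.
    have := ler_wpM2r lnx_ge0 (Ay i); rewrite mulrDl mul1r; lra.
  rewrite lerBlDr.
  apply: (@le_trans _ _ (\sum_j (A i j * ln (X j w) + `|A i j| * ln 2))); last first.
    rewrite big_split /= lerD2l -mulr_suml ler_wpM2r ?row_le //.
    by rewrite ln_ge0 // ler1n.
  rewrite mulr_suml; apply: ler_sum => j _.
  have ln_ge : y j * ln x <= ln (X j w).
    by rewrite -(expRK (y j * ln x)) ler_ln ?posrE ?expR_gt0 // ltW ?(Bw j).1.
  have ln_le : ln (X j w) <= y j * ln x + ln 2.
    rewrite -[leRHS](expRK) ler_ln ?posrE ?expR_gt0 // expRD lnK ?posrE //.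
    by rewrite mulrC (Bw j).2.
  rewrite -mulrA -lerBlDl -mulrBr; apply: le_trans (ler_norm _) _.
  by rewrite normrM ler_wpM2l // ler_norml; lra.
apply: (@le_trans _ _ (fine (P [set w | forall j, B j (X j w)]))); last first.
  by apply: fine_prob_le; [exact: measurable_box | exact: measurable_joint_event |].
rewrite prob_box //.
have -> : - ((1 + dl) * Y) * ln x = \sum_j - ((1 + dl) * (y j * ln x)).
  by rewrite sumrN -mulr_sumr -mulr_suml mulrA mulNr.
rewrite expR_sum -big_split /=; apply: ler_prod => j _.
by rewrite mulr_ge0 ?(ltW (cf_gt0 _)) ?expR_ge0 //= X_lower.
Unshelve. all: by end_near.
Qed.

End lower_bound.

(** * Comparison on the power scale *)

Lemma power_dominated (R : realType) (C p q eps : R) : p < q -> 0 < eps ->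
  \forall x \near +oo, C * expR (p * ln x) <= eps * expR (q * ln x).
Proof.
move=> pq eps_gt0; have qp_gt0 : 0 < q - p by rewrite subr_gt0.
near=> x.
have x_big : expR (C / eps / (q - p)) <= x by near: x; exact: nbhs_pinfty_ge.
have x_gt0 : 0 < x by apply: lt_le_trans x_big; exact: expR_gt0.
have -> : q * ln x = (q - p) * ln x + p * ln x by ring.
rewrite expRD mulrA ler_wpM2r ?expR_ge0 // mulrC -ler_pdivrMr //.
have : C / eps <= (q - p) * ln x.
  by rewrite [leRHS]mulrC -ler_pdivrMr // -[leLHS]expRK ler_ln ?posrE ?expR_gt0.
by have := expR_ge1Dx ((q - p) * ln x); lra.
Unshelve. all: by end_near.
Qed.

Theorem theorem3p1 (d : measure_display) (T : measurableType d) (R : realType)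
    (P : probability T R) (m n : nat) (hnm : (n <= m)%N) (A : 'M[R]_(n, m))
    (X : 'I_m -> {RV P >-> R})
    (X_ge0 : forall j w, 0 <= X j w)
    (X_indep : mutually_independent X)
    (kappa : 'cV[R]_m) (kappa_opt : lp_optimal A kappa) :
  ((forall j, regularly_varying_N1 (X j)) ->
   forall eps : R, 0 < eps ->
     (fun x : R => x `^ (- (\sum_(i < m) kappa i 0) - eps))
       =o_ +oo (joint_tail A X)) /\
  ((forall j, forall delta : R, 0 < delta < 1 ->
      ('E_P[(fun w => (X j w `^ (1 - delta))%R)] < +oo)%E) ->
   (exists2 c : R, 0 < c &
      forall j, kappa j 0 = 0 -> P [set w | c <= X j w] = 1%E) ->
   forall eps : R, 0 < eps ->
     joint_tail A X
       =o_ +oo (fun x : R => x `^ (- (\sum_(i < m) kappa i 0) + eps))).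
Proof.
have powE (x a : R) : 0 < x -> x `^ a = expR (a * ln x).
  by move=> x_gt0; rewrite /powR gt_eqF.
have tail_ge0 x : 0 <= joint_tail A X x by apply: fine_ge0; exact: measure_ge0.
split=> [X_rv eps eps_gt0|X_mom [c c_gt0 X_gec] eps eps_gt0].
  have [c [p [c_gt0 lt_p lower]]] :=
    joint_tail_lower X_indep kappa_opt.1 X_rv eps_gt0.
  apply/eqoP => e e_gt0.
  have dom := power_dominated 1 lt_p (mulr_gt0 e_gt0 c_gt0).
  near=> x.
  have x_gt0 : 0 < x by near: x; exact: nbhs_pinfty_gt.
  have lower_x : c * expR (p * ln x) <= joint_tail A X x by near: x.
  rewrite powE // !ger0_norm ?expR_ge0 //.
  apply: (@le_trans _ _ (e * c * expR (p * ln x))).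
    by rewrite -[leLHS]mul1r; near: x.
  by rewrite -mulrA ler_wpM2l // ltW.
have [C [p [lt_p upper]]] :=
  joint_tail_upper X_ge0 X_indep kappa_opt X_mom c_gt0 X_gec eps_gt0.
apply/eqoP => e e_gt0.
have dom := power_dominated C lt_p e_gt0.
near=> x.
have x_gt0 : 0 < x by near: x; exact: nbhs_pinfty_gt.
rewrite powE // !ger0_norm ?expR_ge0 //.
apply: (@le_trans _ _ (C * expR (p * ln x))); near: x; [exact: upper | exact: dom].
Unshelve. all: by end_near.
Qed.
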